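(* For every $\varepsilon\in(0,1)$ there is a constant $c(\varepsilon)>0$, depending only on $\varepsilon$, such that the following holds. Let $N\in\mathbb{N}$, let $\xi_1,\ldots,\xi_N$ be independent real random variables on a probability space $\Omega$ with $\mathsf{E}\xi_i=0$ and $\mathsf{E}|\xi_i|=1$ for all $i$, and let $\xi=(\xi_1,\ldots,\xi_N)$. Then for every integer $n\ge 0$ with $n\le N(1-\varepsilon)$, $$ d_n^{\mathrm{avg}}(\{\xi_1,\ldots,\xi_N\},L_1(\Omega)) = N^{-1}d_n^{\mathrm{avg}}(\xi,\ell_1^N)\ge c(\varepsilon). $$
   Context: For a subset $Q$ of a normed space $X$, $\rho(x,Q)_X:=\inf_{y\in Q}\|x-y\|_X$. The average Kolmogorov width of a random vector $\xi$ with values in $X$ is $d_n^{\mathrm{avg}}(\xi,X):=\inf_{Q_n}\mathsf{E}\,\rho(\xi,Q_n)_X$, and for a finite set (system) $\{x_1,\ldots,x_N\}\subset X$ it is $d_n^{\mathrm{avg}}(\{x_1,\ldots,x_N\},X):=\inf_{Q_n}\frac1N\sum_{i=1}^N\rho(x_i,Q_n)_X$; in both cases the infimum is over linear subspaces $Q_n\subset X$ of dimension at most $n$. $\ell_1^N$ is $\mathbb{R}^N$ with the norm $\|x\|_1=\sum_{k=1}^N|x_k|$. *)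

(* Defs.v *)
From HB Require Import structures.
From mathcomp Require Import all_boot all_order all_algebra.
From mathcomp Require Import all_classical all_reals all_analysis.
From mathcomp Require Import measurable_realfun.

Set Implicit Arguments.
Unset Strict Implicit.
Unset Printing Implicit Defensive.

Import Order.TTheory GRing.Theory Num.Theory.
Import numFieldNormedType.Exports.

Local Open Scope classical_set_scope.
Local Open Scope ring_scope.
Local Open Scope quotient_scope.

Section KolmogorovWidth.
Context (R : realType) (X : normedModType R).

Definition lin_indep k (b : 'I_k -> X) : Prop :=
  forall a : 'I_k -> R, \sum_i a i *: b i = 0 -> forall i, a i = 0.

Definition lin_span k (b : 'I_k -> X) : set X :=
  [set \sum_i a i *: b i | a in [set: 'I_k -> R]].

Definition subspace_dim_le (n : nat) (Q : set X) : Prop :=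
  exists k (b : 'I_k -> X), [/\ (k <= n)%N, lin_indep b & Q = lin_span b].

(* A real infimum: [inf set0 = 0], so this is meaningful for nonempty [Q]. *)
Definition dist_to (x : X) (Q : set X) : R := inf [set `|x - y| | y in Q].

Definition avg_width (d : measure_display) (T : measurableType d)
    (P : probability T R) (n : nat) (xi : T -> X) : \bar R :=
  ereal_inf [set 'E_P[fun w => dist_to (xi w) Q]%E | Q in subspace_dim_le n].

Definition avg_width_sys (n N : nat) (x : 'I_N -> X) : R :=
  inf [set N%:R^-1 * \sum_i dist_to (x i) Q | Q in subspace_dim_le n].

End KolmogorovWidth.

(* 'rV[R]_N itself carries the sup norm, hence the alias. *)
Definition ell1 (R : realType) (N : nat) : Type := 'rV[R]_N.

Section Ell1.
Context (R : realType) (N : nat).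

HB.instance Definition _ := GRing.Lmodule.copy (ell1 R N) 'rV[R]_N.

Definition ell1_norm (x : ell1 R N) : R := \sum_k `|(x : 'rV_N) 0 k|.

Let ell1_normD (x y : ell1 R N) :
  ell1_norm (x + y) <= ell1_norm x + ell1_norm y.
Proof.
by rewrite -big_split; apply: ler_sum => k _; rewrite !mxE ler_normD.
Qed.

Let ell1_normZ (l : R) (x : ell1 R N) :
  ell1_norm (l *: x) = `|l| * ell1_norm x.
Proof. by rewrite mulr_sumr; apply: eq_bigr => k _; rewrite mxE normrM. Qed.

Let ell1_norm0_eq0 (x : ell1 R N) : ell1_norm x = 0 -> x = 0.
Proof.
move=> /eqP; rewrite psumr_eq0; last by move=> i _; exact: normr_ge0.
move=> /allP x0; apply/rowP => k; rewrite mxE.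
by apply/eqP; rewrite -normr_eq0; apply: x0; rewrite mem_index_enum.
Qed.

HB.instance Definition _ :=
  Lmodule_isNormed.Build R (ell1 R N) ell1_normD ell1_normZ ell1_norm0_eq0.

Lemma ell1_normE (x : ell1 R N) : `|x| = \sum_k `|(x : 'rV_N) 0 k|.
Proof. by []. Qed.

End Ell1.

(* The library has integrable functions ([LfunType mu (lexx 1)], an lmodType)
   and the set of their a.e.-classes, but no linear structure on the latter:
   L_1(mu) is the quotient of the former by the functions vanishing a.e. *)
Section L1space.
Context (d : measure_display) (T : measurableType d) (R : realType).
Variable mu : {measure set T -> \bar R}.
Local Notation Lfun1 := (LfunType mu (@lexx _ _ 1%E)).

Definition null_fun : {pred Lfun1} :=
  [pred f : Lfun1 | `[< \forall x \ae mu, f x = 0 >]].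

Lemma null_funP (f : Lfun1) :
  reflect (\forall x \ae mu, f x = 0) (f \in null_fun).
Proof. exact: asboolP. Qed.

Let null_fun_zmod_closed : zmod_closed null_fun.
Proof.
split; first by apply/null_funP; apply: aeW.
move=> f g /null_funP f0 /null_funP g0; apply/null_funP.
apply: filterS2 f0 g0 => x /= fx gx.
by rewrite -[LHS]/(f x - g x) fx gx subr0.
Qed.

HB.instance Definition _ :=
  GRing.isZmodClosed.Build Lfun1 null_fun null_fun_zmod_closed.

Lemma null_funZ (a : R) (f : Lfun1) : f \in null_fun -> a *: f \in null_fun.
Proof.
move=> /null_funP f0; apply/null_funP; apply: filterS f0 => x fx.
by rewrite -[LHS]/(a * f x) fx mulr0.
Qed.

Definition L1 : Type := Quotient.quot null_fun.
HB.instance Definition _ := GRing.Zmodule.on L1.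
HB.instance Definition _ :=
  ZmodQuotient.copy L1 (Quotient.quot null_fun).

Lemma L1_eqP (f g : Lfun1) :
  reflect (\forall x \ae mu, f x = g x) (\pi_L1 f == \pi_L1 g).
Proof.
rewrite -[X in reflect _ X](Quotient.idealrBE null_fun).
apply: (iffP (null_funP _)); apply: filterS => x.
  by move=> /eqP; rewrite -[X in X == _]/(f x - g x) subr_eq0 => /eqP.
by rewrite -[X in _ -> X = _]/(f x - g x) => ->; rewrite subrr.
Qed.

Definition L1_scale (a : R) (x : L1) : L1 := \pi_L1 (a *: (repr x : Lfun1)).

Lemma pi_L1Z (a : R) (f : Lfun1) : \pi_L1 (a *: f) = L1_scale a (\pi_L1 f).
Proof.
apply/eqP; rewrite -(Quotient.idealrBE null_fun) -scalerBr null_funZ//.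
by rewrite (Quotient.idealrBE null_fun) reprK.
Qed.

Lemma pi_L1D (f g : Lfun1) : \pi_L1 (f + g) = \pi_L1 f + \pi_L1 g.
Proof. exact: (@Quotient.pi_add _ null_fun). Qed.

Let L1_scaleA a b x : L1_scale a (L1_scale b x) = L1_scale (a * b) x.
Proof. by rewrite [L1_scale b x]/L1_scale -pi_L1Z scalerA. Qed.

Let L1_scale1 : left_id 1 L1_scale.
Proof. by move=> x; rewrite /L1_scale scale1r reprK. Qed.

Let L1_scaleDr : right_distributive L1_scale +%R.
Proof.
move=> a x y; rewrite {2 3}/L1_scale -pi_L1D -scalerDr pi_L1Z.
by rewrite pi_L1D !reprK.
Qed.

Let L1_scaleDl x : {morph L1_scale^~ x : a b / a + b}.
Proof. by move=> a b; rewrite /L1_scale scalerDl; exact: pi_L1D. Qed.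

HB.instance Definition _ := GRing.Zmodule_isLmodule.Build R L1
  L1_scaleA L1_scale1 L1_scaleDr L1_scaleDl.

Definition L1_norm (x : L1) : R :=
  fine ('N[mu]_1%E[EFin \o (repr x : Lfun1)])%E.

Lemma L1_norm_pi (f : Lfun1) :
  L1_norm (\pi_L1 f) = fine ('N[mu]_1%E[EFin \o f])%E.
Proof.
have /eqP/L1_eqP ae_f : \pi_L1 (repr (\pi_L1 f)) = \pi_L1 f by rewrite reprK.
rewrite /L1_norm !Lnorm1; congr fine; apply: ae_eq_integral => //.
1,2: apply: measurableT_comp => //; apply/measurable_EFinP;
  exact: measurable_funPT.
by apply: filterS ae_f => x /= -> _.
Qed.

Let L1_normD (x y : L1) : L1_norm (x + y) <= L1_norm x + L1_norm y.
Proof.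
by rewrite -[x]reprK -[y]reprK -pi_L1D !L1_norm_pi ler_LnormD.
Qed.

Let L1_normZ (a : R) (x : L1) : L1_norm (a *: x) = `|a| * L1_norm x.
Proof.
rewrite -[x]reprK -[a *: _]pi_L1Z !L1_norm_pi.
apply: EFin_inj; rewrite EFinM !finite_norm_fine.
exact: LnormZ.
Qed.

Let L1_norm0_eq0 (x : L1) : L1_norm x = 0 -> x = 0.
Proof.
rewrite -[x]reprK L1_norm_pi => /fine_Lnormr_eq0 f0.
rewrite -[0 in RHS]reprK; apply/eqP.
have -> : \pi_L1 (repr (0 : L1)) = \pi_L1 (0 : Lfun1).
  by rewrite reprK; apply/esym; exact: (@pi_zeror _ _ _ _ _ L1).
apply/L1_eqP.
by apply: filterS f0 => t /(_ I).
Qed.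

HB.instance Definition _ :=
  Lmodule_isNormed.Build R L1 L1_normD L1_normZ L1_norm0_eq0.

Lemma L1_norm_piE (f : Lfun1) :
  (`|\pi_L1 f : L1|%:E = \int[mu]_x `|f x|%:E)%E.
Proof. by rewrite -[`|_|]/(L1_norm _) L1_norm_pi finite_norm_fine Lnorm1. Qed.

(* The a.e.-class of [f] when [f] is integrable, and the junk value 0 else. *)
Definition to_L1 (f : T -> R) : L1 := \pi_L1 (insubd (0 : Lfun1) f).

Lemma to_L1E (f : Lfun1) : to_L1 f = \pi_L1 f.
Proof. by rewrite /to_L1 valKd. Qed.

Lemma norm_to_L1 (f : T -> R) : mu.-integrable [set: T] (EFin \o f) ->
  (`|to_L1 f|%:E = \int[mu]_x `|f x|%:E)%E.
Proof.
move=> /Lfun1_integrable f1.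
by rewrite -[f](@Lfun_valP _ _ _ mu _ (@lexx _ _ 1%E) f f1) to_L1E L1_norm_piE.
Qed.

End L1space.

Section Independence.
Context (d : measure_display) (T : measurableType d) (R : realType).
Variable P : probability T R.

Definition mutually_independent (I : finType) (X : I -> {RV P >-> R}) : Prop :=
  forall (J : {set I}) (A : I -> set R),
    (forall i, i \in J -> measurable (A i)) ->
    P (\bigcap_(i in [set` J]) X i @^-1` A i) =
      (\prod_(i in J) P (X i @^-1` A i))%E.

End Independence.

(* Main.v *)
Require Import Defs.
From HB Require Import structures.
From mathcomp Require Import all_boot all_order all_algebra.
From mathcomp Require Import ring lra.
From mathcomp Require Import all_classical all_reals all_analysis.
From mathcomp Require Import measurable_realfun.

(** The two widths coincide because an approximation of the random vector [xi]
    by [\sum_j a j w *: b j] and an approximation of the family of functions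
    [xi i] by [\sum_j b j i *: a j] are given by the same functions [a j] and
    vectors [b j], with the same error [\sum_i E |xi i - \sum_j b j i * a j|].
    One direction needs coefficients [a j] that are measurable and integrable;
    they are obtained by selecting the best of finitely many rational points
    of the subspace ([best], [integral_err_cvg]).

    The lower bound is by duality.  If [z] is orthogonal to [Q] and its entries
    are at most [K + 2] in absolute value, then [<x, z> <= (K + 2) * rho(x, Q)].
    So it is enough to find a random [z], bounded and orthogonal to [Q], for
    which [E <xi, z>] is of order [N].  Projecting the sign vector of [xi] to
    the orthogonal complement of [Q] gives the right correlation, but the
    entries of the projection are not bounded.  They are kept bounded by a
    random walk that reveals the signs one coordinate at a time ([walk]): at
    time [j] it adds [s j *: v j], where [s j] is the centered sign of [xi j]
    and [v j] is the projection of the basis vector [e_j] to those vectors of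
    the complement of [Q] that vanish at the frozen coordinates, i.e., at those
    where the walk has already exceeded [K].

    - As [s j] is centered and independent of everything else that occurs in
      [<xi, s j *: v j>] except for [xi j], and [E (s j * xi j) = E |xi j| = 1],
      the step increases [E <xi, z>] by the diagonal entry at [j] of the
      projector in use.  Projectors only shrink along the walk, so [E <xi, z>]
      is at least the mean trace of the last one, i.e., at least
      [N - n - E #frozen] ([mean_walk_gain]).
    - The walk is a martingale with [E |z|^2 <= N] ([mean_walk_sqnorm]), and
      every frozen coordinate contributes at least [K^2] to [|z|^2]; hence
      [E #frozen <= N / K^2].

    With [K = 2 / eps] this yields the constant [eps^2 / 8].  The walk depends
    on the signs of [xi] only, so that the probabilistic part reduces to finite
    sums over sign patterns with product weights; independence enters through
    the integral of [xi i] over the event that the sign pattern is prescribed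
    ([integral_xi_cell]). *)

Set Implicit Arguments.
Unset Strict Implicit.
Unset Printing Implicit Defensive.

Import Order.TTheory GRing.Theory Num.Theory.
Import numFieldNormedType.Exports.

Local Open Scope ring_scope.

(** * Orthogonal projectors over a real field *)

Section OrthogonalProjector.
Context (R : realFieldType) (N : nat).

Lemma row_sqnorm_eq0 (u : 'rV[R]_N) : u *m u^T = 0 -> u = 0.
Proof.
move=> /matrixP /(_ 0 0); rewrite !mxE => u0; apply/rowP => i; rewrite mxE.
have /eqP : \sum_j u 0 j ^+ 2 = 0.
  by rewrite -[RHS]u0; apply: eq_bigr => j _; rewrite mxE expr2.
rewrite psumr_eq0 => [/allP /(_ i (mem_index_enum _))|j _]; last exact: sqr_ge0.
by rewrite sqrf_eq0 => /eqP.
Qed.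

(** Over an ordered field [u *m A] vanishes as soon as its square norm does. *)
Lemma gram_unitmx k (A : 'M[R]_(k, N)) : row_free A -> A *m A^T \in unitmx.
Proof.
move=> Afree; rewrite -row_free_unit; apply: inj_row_free => u uAA.
apply/eqP; rewrite -(mulmx_free_eq0 u Afree); apply/eqP/row_sqnorm_eq0.
by rewrite trmx_mul mulmxA -[u *m A *m A^T]mulmxA uAA mul0mx.
Qed.

(** The orthogonal projector to the complement of the row space of [M]. *)
Definition orth_proj m (M : 'M[R]_(m, N)) : 'M[R]_N :=
  let A := row_base M in 1%:M - A^T *m invmx (A *m A^T) *m A.

Section Properties.
Context (m : nat) (M : 'M[R]_(m, N)).
Local Notation P := (orth_proj M).
Local Notation A := (row_base M).

Let gramU : A *m A^T \in unitmx.
Proof. exact/gram_unitmx/row_base_free. Qed.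

Lemma orth_proj_tr : P^T = P.
Proof.
rewrite /orth_proj; move: (row_base M) => B.
rewrite raddfB/= trmx1; congr (_ - _).
by rewrite !trmx_mul trmxK trmx_inv trmx_mul trmxK mulmxA.
Qed.

Lemma orth_proj_sym i j : P i j = P j i.
Proof. by rewrite -[in LHS]orth_proj_tr mxE. Qed.

Lemma mul_base_orth_proj : A *m P = 0.
Proof.
by rewrite /orth_proj mulmxBr mulmx1 !mulmxA mulmxV// mul1mx subrr.
Qed.

Lemma mul_orth_proj m' (M' : 'M[R]_(m', N)) : (M' <= M)%MS -> M' *m P = 0.
Proof.
rewrite -(eq_row_base M) => /submxP[D ->].
by rewrite -mulmxA mul_base_orth_proj mulmx0.
Qed.

Lemma orth_projM m' (M' : 'M[R]_(m', N)) : (M' <= M)%MS -> orth_proj M' *m P = P.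
Proof.
move=> le; have le' : (row_base M' <= M)%MS by rewrite eq_row_base.
by rewrite [orth_proj M']/orth_proj mulmxBl mul1mx -(mulmxA _ (row_base M'))
  (mul_orth_proj le') mulmx0 subr0.
Qed.

(** [P] is symmetric and idempotent, so that its diagonal consists of the
    square norms of its rows. *)
Lemma orth_proj_diag j : P j j = \sum_i P j i ^+ 2.
Proof.
rewrite -[in LHS](orth_projM (submx_refl M)) mxE; apply: eq_bigr => i _.
by rewrite [P i j]orth_proj_sym expr2.
Qed.

Lemma orth_proj_diag_ge0 j : 0 <= P j j.
Proof. by rewrite orth_proj_diag sumr_ge0 // => i _; exact: sqr_ge0. Qed.

Lemma orth_proj_diag_le1 j : P j j <= 1.
Proof.
have : P j j ^+ 2 <= P j j.
  rewrite [leRHS]orth_proj_diag (bigD1 j)//= lerDl.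
  by rewrite sumr_ge0 // => i _; exact: sqr_ge0.
have := orth_proj_diag_ge0 j; nra.
Qed.

Lemma normr_orth_proj_le1 j i : `|P j i| <= 1.
Proof.
rewrite -(expr_le1 (ltn0Sn 1)) // real_normK ?num_real//.
apply: le_trans (orth_proj_diag_le1 j); rewrite orth_proj_diag (bigD1 i)//= lerDl.
by rewrite sumr_ge0 // => ? _; exact: sqr_ge0.
Qed.

Lemma mxtrace_orth_proj : \tr P = N%:R - (\rank M)%:R.
Proof.
rewrite /orth_proj linearB/= mxtrace1; congr (_ - _).
by rewrite -mulmxA mxtrace_mulC -mulmxA mulVmx// mxtrace1.
Qed.

End Properties.

(** A larger space has a smaller orthogonal complement: the difference of the
    two projectors is again a projector, whose diagonal is nonnegative. *)
Lemma orth_proj_diag_anti m m' (M : 'M[R]_(m, N)) (M' : 'M[R]_(m', N)) j :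
  (M' <= M)%MS -> orth_proj M j j <= orth_proj M' j j.
Proof.
move=> le; set P := orth_proj M; set P' := orth_proj M'.
have P'P : P' *m P = P by exact: orth_projM.
have PP' : P *m P' = P.
  by rewrite -[LHS]trmxK trmx_mul !orth_proj_tr P'P orth_proj_tr.
have PP : P *m P = P by exact: orth_projM.
have P'P' : P' *m P' = P' by exact: orth_projM.
have symP i k : P i k = P k i by exact: orth_proj_sym.
have symP' i k : P' i k = P' k i by exact: orth_proj_sym.
clearbody P P'.
have D2 : (P' - P) *m (P' - P) = P' - P.
  by rewrite mulmxBl !mulmxBr P'P PP' PP P'P' subrr subr0.
have -> : P' j j = P j j + (P' - P) j j by rewrite 2!mxE; ring.
rewrite lerDl -D2 mxE sumr_ge0 // => i _; rewrite !mxE.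
by rewrite [P' i j]symP' [P i j]symP -expr2 sqr_ge0.
Qed.

End OrthogonalProjector.

(** * Means over sign patterns *)

Section ProductMean.
Context (R : realFieldType) (I : finType) (mu : I -> bool -> R).
Hypothesis mu_ge0 : forall i b, 0 <= mu i b.
Hypothesis mu_total : forall i, mu i true + mu i false = 1.

Local Notation pattern := {ffun I -> bool}.

(** The expectation of [G] of a family of independent booleans, the [i]-th of
    which has the law [mu i]. *)
Definition mean (G : pattern -> R) : R :=
  \sum_(t : pattern) (\prod_i mu i (t i)) * G t.

Lemma eq_mean G1 G2 : G1 =1 G2 -> mean G1 = mean G2.
Proof. by move=> G12; apply: eq_bigr => t _; rewrite G12. Qed.

Lemma le_mean G1 G2 : (forall t, G1 t <= G2 t) -> mean G1 <= mean G2.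
Proof.
by move=> le12; apply: ler_sum => t _; rewrite ler_wpM2l// prodr_ge0.
Qed.

Lemma meanD G1 G2 : mean (fun t => G1 t + G2 t) = mean G1 + mean G2.
Proof. by rewrite -big_split; apply: eq_bigr => t _; rewrite mulrDr. Qed.

Lemma meanZ a G : mean (fun t => a * G t) = a * mean G.
Proof. by rewrite mulr_sumr; apply: eq_bigr => t _; rewrite mulrCA. Qed.

Lemma mean_sum (J : finType) (G : J -> pattern -> R) :
  mean (fun t => \sum_j G j t) = \sum_j mean (G j).
Proof.
by rewrite exchange_big; apply: eq_bigr => t _; rewrite mulr_sumr.
Qed.

Lemma mean_cst a : mean (fun=> a) = a.
Proof.
rewrite /mean -mulr_suml.
have <- : \prod_i \sum_b mu i b = \sum_(t : pattern) \prod_i mu i (t i).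
  exact: bigA_distr_bigA.
by rewrite big1 ?mul1r// => i _; rewrite big_bool /= mu_total.
Qed.

Definition blind (j : I) (T : Type) (g : pattern -> T) : Prop :=
  forall t t' : pattern, (forall i, i != j -> t i = t' i) -> g t = g t'.

(** Pairing each pattern with the one that differs only at [j], the two terms
    have the same factors except for those at [j], which add up to 0. *)
Lemma mean_centered j (f : bool -> R) (g : pattern -> R) :
  mu j true * f true + mu j false * f false = 0 -> blind j g ->
  mean (fun t => f (t j) * g t) = 0.
Proof.
move=> f0 gj.
pose flip (t : pattern) : pattern := [ffun i => if i == j then ~~ t i else t i].
have flipK : involutive flip.
  by move=> t; apply/ffunP => i; rewrite !ffunE; case: eqP; rewrite ?negbK.
have flipj t : flip t j = ~~ t j by rewrite ffunE eqxx.
have flipN t i : i != j -> flip t i = t i by rewrite ffunE => /negbTE ->.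
set S := mean _.
suff : S + S = 0 by lra.
rewrite {1}/S /mean (reindex_inj (inv_inj flipK)) -big_split big1//= => t _.
rewrite (bigD1 j)//= [X in _ + X * _](bigD1 j)//= flipj (gj _ t);
  last exact: flipN.
rewrite (eq_bigr (fun i => mu i (t i))); last by move=> i ij; rewrite flipN.
set W := \prod_(i | _) _; case: (t j) => /=.
  rewrite -[RHS](mulr0 (W * g t)) -f0; ring.
rewrite -[RHS](mulr0 (W * g t)) -f0; ring.
Qed.

End ProductMean.

(** * The walk with frozen coordinates *)

Section FrozenWalk.
Context (R : realFieldType) (N k : nat) (B : 'M[R]_(k, N)) (K : R).
Hypothesis K_gt0 : 0 < K.

Definition frozen (z : 'rV[R]_N) : {set 'I_N} := [set i | K < `|z 0 i|].

(** Its row space is orthogonal to the directions in which the walk may move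
    from [z]. *)
Definition constraint_mx (z : 'rV[R]_N) : 'M[R]_N :=
  (B + \sum_(i in frozen z) delta_mx i i)%MS.

Definition free_proj z : 'M[R]_N := orth_proj (constraint_mx z).

Lemma mul_free_proj z : B *m free_proj z = 0.
Proof. exact/mul_orth_proj/addsmxSl. Qed.

Lemma free_proj_frozen z i j : i \in frozen z -> free_proj z j i = 0.
Proof.
move=> iF; rewrite [LHS]orth_proj_sym.
have : delta_mx 0 i *m free_proj z = 0 :> 'rV[R]_N.
  apply: mul_orth_proj; apply: submx_trans (addsmxSr _ _).
  apply: submx_trans (sumsmx_sup i iF (submx_refl _)).
  by rewrite -(mul_delta_mx i (0 : 'I_1) i) submxMl.
by rewrite -rowE => /rowP /(_ j); rewrite !mxE.
Qed.

Lemma mxrank_constraint z : (\rank (constraint_mx z) <= k + #|frozen z|)%N.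
Proof.
apply: leq_trans (mxrank_adds_leqif _ _).1 _.
apply: leq_add; first exact: rank_leq_row.
apply: leq_trans (mxrank_sum_leqif _).1 _ => /=.
rewrite -sum1_card; apply: leq_sum => i _.
by rewrite /= mxrank_delta.
Qed.

Lemma free_proj_mono z z' j : frozen z \subset frozen z' ->
  free_proj z' j j <= free_proj z j j.
Proof.
move=> /fintype.subsetP zz'; apply: orth_proj_diag_anti; apply: addsmxS => //.
by apply/sumsmx_subP => i /zz' iF; rewrite (sumsmx_sup i).
Qed.

Lemma mxtrace_free_proj z : N%:R - k%:R - #|frozen z|%:R <= \tr (free_proj z).
Proof.
rewrite mxtrace_orth_proj -addrA -opprD lerB// -natrD ler_nat.
exact: mxrank_constraint.
Qed.

(** [s j] is the centered sign of the [j]-th variable, and [h j] stands for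
    its conditional expectation given its sign. *)
Variables (mu s h : 'I_N -> bool -> R).
Hypothesis mu_ge0 : forall i b, 0 <= mu i b.
Hypothesis mu_total : forall i, mu i true + mu i false = 1.
Hypothesis s_centered : forall j,
  mu j true * s j true + mu j false * s j false = 0.
Hypothesis s_le2 : forall j b, `|s j b| <= 2.
Hypothesis s_var : forall j,
  mu j true * s j true ^+ 2 + mu j false * s j false ^+ 2 <= 1.
Hypothesis sh : forall j,
  mu j true * (s j true * h j true) + mu j false * (s j false * h j false) = 1.

Local Notation pattern := {ffun 'I_N -> bool}.

Definition step (t : pattern) (z : 'rV[R]_N) (j : 'I_N) : 'rV[R]_N :=
  z + s j (t j) *: row j (free_proj z).

Definition walk (l : seq 'I_N) (t : pattern) : 'rV[R]_N := foldl (step t) 0 l.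

Lemma walk_rcons l j t : walk (rcons l j) t = step t (walk l t) j.
Proof. exact: foldl_rcons. Qed.

Lemma stepE t z j i : step t z j 0 i = z 0 i + s j (t j) * free_proj z j i.
Proof. by rewrite !mxE. Qed.

Lemma walk_blind l j : j \notin l -> blind j (walk l).
Proof.
move=> jl t t' tt'; elim/last_ind: l jl => [//|l i IH].
rewrite mem_rcons inE negb_or => /andP[ji jl].
by rewrite !walk_rcons /step IH// tt'// eq_sym.
Qed.

Lemma walk_orth l t : walk l t *m B^T = 0.
Proof.
elim/last_ind: l => [|l j IH]; first by rewrite mul0mx.
rewrite walk_rcons mulmxDl IH add0r -scalemxAl -row_mul.
by rewrite -[free_proj _]orth_proj_tr -trmx_mul mul_free_proj trmx0 row0 scaler0.
Qed.

(** A coordinate moves only while it is at most [K], and by at most 2. *)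
Lemma walk_bound l t i : `|walk l t 0 i| <= K + 2.
Proof.
elim/last_ind: l => [|l j IH]; first by rewrite mxE normr0 addr_ge0 ?ltW.
rewrite walk_rcons stepE; have [iF|] := boolP (i \in frozen (walk l t)).
  by rewrite free_proj_frozen// mulr0 addr0.
rewrite inE -leNgt => zK; apply: le_trans (ler_normD _ _) _; apply: lerD => //.
by rewrite normrM -[leRHS]mulr1 ler_pM ?normr_orth_proj_le1.
Qed.

(** A frozen coordinate no longer moves, hence stays above [K]. *)
Lemma frozen_step t z j : frozen z \subset frozen (step t z j).
Proof.
apply/fintype.subsetP => i iF; move: (iF); rewrite !inE stepE.
by rewrite free_proj_frozen// mulr0 addr0.
Qed.

(** The increments are orthogonal, and the mean square norm of the [j]-th one
    is at most that of a projected basis vector. *)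
Lemma mean_walk_sqnorm l : uniq l ->
  mean mu (fun t => \sum_i walk l t 0 i ^+ 2) <= (size l)%:R.
Proof.
elim/last_ind: l => [_|l j IH].
  rewrite (@eq_mean _ _ _ _ (fun=> 0)) ?mean_cst// => t.
  by rewrite big1// => i _; rewrite mxE expr0n.
rewrite rcons_uniq => /andP[jl] /IH{}IH; rewrite size_rcons -natr1.
have zj := walk_blind jl.
(* Expand the square; the cross terms have mean zero. *)
rewrite (eq_mean _ (G2 := fun t => \sum_i walk l t 0 i ^+ 2 +
  (s j (t j) * (2 * \sum_i walk l t 0 i * free_proj (walk l t) j i) +
   s j (t j) ^+ 2 * free_proj (walk l t) j j))); last first.
  move=> t; rewrite orth_proj_diag walk_rcons !mulr_sumr -!big_split/=.
  by apply: eq_bigr => i _; rewrite stepE; ring.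
rewrite 2!meanD (mean_centered (f := s j)) //; last by move=> t t' /zj ->.
rewrite add0r; apply: lerD => //.
(* The variance [c] of [s j] factors out of the mean. *)
set c := mu j true * s j true ^+ 2 + mu j false * s j false ^+ 2.
rewrite (eq_mean _ (G2 := fun t =>
  (s j (t j) ^+ 2 - c) * free_proj (walk l t) j j +
  c * free_proj (walk l t) j j));
  last by move=> t; ring.
rewrite meanD (mean_centered (f := fun b => s j b ^+ 2 - c)); first last.
- by move=> t t' /zj ->.
- rewrite [LHS](_ : _ = c - (mu j true + mu j false) * c).
    by rewrite mu_total; ring.
  by rewrite /c; ring.
rewrite add0r -[leRHS](mean_cst mu_total); apply: le_mean => // t.
rewrite -[leRHS]mulr1 ler_pM ?orth_proj_diag_ge0 ?orth_proj_diag_le1//.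
  by rewrite addr_ge0// mulr_ge0// sqr_ge0.
exact: s_var.
Qed.

(** In [<h, s j *: v j>] only the entry at [j] contributes to the mean, since
    [s j] is centered; by [sh] its contribution is the diagonal entry at [j] of
    the projector in use.  Replacing the earlier projectors by the current,
    smaller one decreases their diagonal entries. *)
Lemma mean_walk_gain l : uniq l ->
  mean mu (fun t => \sum_(j <- l) free_proj (walk l t) j j) <=
  mean mu (fun t => \sum_i h i (t i) * walk l t 0 i).
Proof.
elim/last_ind: l => [_|l j IH].
  by apply: le_mean => // t; rewrite big_nil big1// => i _; rewrite mxE mulr0.
rewrite rcons_uniq => /andP[jl] /IH{}IH.
have zj := walk_blind jl.
apply: (@le_trans _ _ (mean mu (fun t => \sum_(i <- l) free_proj (walk l t) i i +
    free_proj (walk l t) j j))).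
  apply: le_mean => // t; rewrite -cats1 big_cat big_seq1 cats1 walk_rcons.
  apply: lerD; last exact/free_proj_mono/frozen_step.
  by apply: ler_sum => i _; exact/free_proj_mono/frozen_step.
rewrite [leRHS](@eq_mean _ _ _ _ (fun t => \sum_i h i (t i) * walk l t 0 i +
  \sum_i s j (t j) * (h i (t i) * free_proj (walk l t) j i))); last first.
  move=> t; rewrite -big_split; apply: eq_bigr => i _.
  by rewrite walk_rcons stepE/=; ring.
rewrite [leLHS]meanD [leRHS]meanD; apply: lerD => //.
rewrite [leRHS]mean_sum (bigD1 j)//= [X in _ + X]big1 => [|i ij]; last first.
  by apply: mean_centered => // t t' tt'; rewrite tt'// (zj _ _ tt').
rewrite addr0 -subr_ge0 -mulN1r -meanZ -meanD.
rewrite (eq_mean _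
  (G2 := fun t => (s j (t j) * h j (t j) - 1) * free_proj (walk l t) j j));
  last by move=> t; ring.
rewrite (mean_centered (f := fun b => s j b * h j b - 1))// => [|t t' /zj -> //].
rewrite [LHS](_ : _ = 1 - (mu j true + mu j false)).
  by rewrite mu_total subrr.
by rewrite -[X in _ = X - _](sh j); ring.
Qed.

(** The walk through all the coordinates.  The term [N / K^2] bounds the mean
    number of frozen coordinates, each of which may lower the trace by 1. *)
Theorem exists_correlated_certificate : exists z : pattern -> 'rV[R]_N,
  [/\ forall t, z t *m B^T = 0,
      forall t i, `|z t 0 i| <= K + 2 &
      N%:R - k%:R - N%:R / K ^+ 2 <=
        mean mu (fun t => \sum_i h i (t i) * z t 0 i)].
Proof.
exists (walk (enum 'I_N)); split; [exact: walk_orth|exact: walk_bound|].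
have uN := enum_uniq 'I_N.
apply: le_trans (mean_walk_gain uN).
rewrite (eq_mean _
  (G2 := fun t => \tr (free_proj (walk (enum 'I_N) t)))); last first.
  by move=> t; rewrite big_enum.
set z := walk _.
(* Markov's inequality for the number of coordinates that exceed [K]. *)
have sqK : mean mu (fun t => K ^+ 2 * #|frozen (z t)|%:R) <= N%:R.
  rewrite -[in leRHS](size_enum_ord N); apply: le_trans (mean_walk_sqnorm uN).
  apply: le_mean => // t; rewrite -sum1_card natr_sum mulr_sumr.
  rewrite [leRHS](bigID [in frozen (z t)])/= -[leLHS]addr0 lerD//.
    apply: ler_sum => i; rewrite inE mulr1 => /ltW zK.
    by rewrite -[leRHS]real_normK ?num_real// ler_pXn2r ?nnegrE// ltW.
  by apply: sumr_ge0 => i _; exact: sqr_ge0.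
apply: le_trans (le_mean mu_ge0 (fun t => mxtrace_free_proj (z t))).
rewrite (eq_mean _
  (G2 := fun t => N%:R - k%:R + (-1) * #|frozen (z t)|%:R));
  last by move=> t; ring.
rewrite meanD mean_cst// meanZ mulN1r lerD2l lerN2 ler_pdivlMr ?exprn_gt0//.
by rewrite mulrC -meanZ.
Qed.

End FrozenWalk.

Local Open Scope classical_set_scope.
Local Open Scope ring_scope.

(** * Sign patterns of independent variables *)

Section SignCells.
Context (R : realType) (d : measure_display) (T : measurableType d).
Variable P : probability T R.

(** Layer-cake: [E (Y 1_B)] is the integral over [r >= 0] of [P (Y > r, B)],
    which factors. *)
Lemma integral_indep_indic (Y : {RV P >-> R}) (B : set T) : measurable B ->
    (forall w, 0 <= Y w) ->
    (forall r, 0 <= r -> P (Y @^-1` `]r, +oo[ `&` B) =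
      (P (Y @^-1` `]r, +oo[) * P B)%E) ->
  (\int[P]_w (Y w * \1_B w)%:E = P B * \int[P]_w (Y w)%:E)%E.
Proof.
move=> mB Y0 indep.
have mYB : measurable_fun setT (fun w => Y w * \1_B w).
  by apply: measurable_funM => //; exact: measurable_indic.
pose YBm := isMeasurableFun.Build _ _ _ _ _ mYB.
pose YB : {RV P >-> R} := HB.pack (fun w => Y w * \1_B w) YBm.
have YB0 w : 0 <= YB w by rewrite /= mulr_ge0.
have := ge0_expectation_ccdf YB0; rewrite unlock => ->.
have := ge0_expectation_ccdf Y0; rewrite unlock => ->.
rewrite -ge0_integralZl//; last first.
  by apply: (measurable_funTS); exact: ccdf_measurable.
apply: eq_integral => r; rewrite inE/= in_itv/= andbT => r0.
rewrite /ccdf /distribution /pushforward muleC -indep//; congr (P _).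
apply/seteqP; split => w /=; rewrite !in_itv/= !andbT indicE.
  have [/set_mem Bw|_] := boolP (w \in B); first by rewrite mulr1.
  by rewrite mulr0 ltNge r0.
by move=> [rY Bw]; rewrite mem_set// mulr1.
Qed.

Lemma integrable_mul_indic (f : T -> R) (B : set T) : measurable B ->
  P.-integrable setT (EFin \o f) ->
  P.-integrable setT (fun w => (f w * \1_B w)%:E).
Proof.
move=> mB intf.
apply: (@integrableMl _ _ _ P _ _ (EFin \o f) (\1_B)) => //.
exists 1; split => // x x1 w _ /=; rewrite (le_trans _ (ltW x1))// indicE.
by case: (_ \in _); rewrite ?normr1 ?normr0.
Qed.

Definition sgnb (b : bool) : R := if b then 1 else -1.

Definition half_line (b : bool) : set R := [set x | (0 < x) = b].

Lemma measurable_half_line b : measurable (half_line b).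
Proof.
rewrite (_ : half_line b = if b then [set` `]0, +oo[] else [set` `]-oo, 0]]).
  by case: b; exact: measurable_itv.
apply/seteqP; case: b; split => x; rewrite /half_line /= in_itv/= ?andbT//.
  by move=> /negbT; rewrite -leNgt.
by rewrite leNgt => /negbTE.
Qed.

(** The positive part of [x] when [b] is [true], the negative part otherwise. *)
Definition half_part (b : bool) (x : R) : R := (`|x| + sgnb b * x) / 2.

Lemma half_part_ge0 b x : 0 <= half_part b x.
Proof.
rewrite /half_part divr_ge0//; case: b; rewrite /sgnb ?mul1r ?mulN1r.
  by have := ler_normr (- x) (- x); rewrite normrN lexx => /esym; lra.
by rewrite subr_ge0 ler_norm.
Qed.

Lemma half_part_indic b x : sgnb b * half_part b x = x * ((0 < x) == b)%:R.
Proof.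
rewrite /half_part /sgnb; case: b; case: ltP => x0 /=.
- by rewrite gtr0_norm//; lra.
- by rewrite ler0_norm//; lra.
- by rewrite gtr0_norm//; lra.
- by rewrite ler0_norm//; lra.
Qed.

Lemma measurable_half_part b : measurable_fun setT (half_part b).
Proof.
apply: measurable_funM => //.
apply: measurable_funD; first exact: normr_measurable.
exact: measurable_funM.
Qed.

Context (N : nat) (xi : 'I_N -> {RV P >-> R}).
Hypothesis indep : mutually_independent xi.
Hypothesis centered : (forall i, 'E_P[xi i] = 0%:E)%E.
Hypothesis norm1 : (forall i, 'E_P[fun w => `|xi i w|%R] = 1%:E)%E.

Local Notation pattern := {ffun 'I_N -> bool}.

Lemma integrable_xi i : P.-integrable setT (EFin \o xi i).
Proof.
apply/integrableP; split.
  by apply/measurable_EFinP; exact: measurable_funPT.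
by have := norm1 i; rewrite unlock => /= ->; rewrite ltry.
Qed.

Definition sgn_pattern (w : T) : pattern := [ffun i => 0 < xi i w].

Definition sgn_prob (i : 'I_N) (b : bool) : R :=
  fine (P (xi i @^-1` half_line b)).

Lemma measurable_half i b : measurable (xi i @^-1` half_line b).
Proof.
rewrite -[X in measurable X]setTI; apply: measurable_funPT => //.
exact: measurable_half_line.
Qed.

Lemma sgn_probE i b : P (xi i @^-1` half_line b) = (sgn_prob i b)%:E.
Proof.
by rewrite /sgn_prob fineK// fin_num_measure//; exact: measurable_half.
Qed.

Lemma sgn_prob_ge0 i b : 0 <= sgn_prob i b.
Proof. exact: fine_ge0. Qed.

Lemma sgn_prob_total i : sgn_prob i true + sgn_prob i false = 1.
Proof.
apply: EFin_inj; rewrite EFinD -!sgn_probE -measureU.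
- rewrite -(probability_setT P); congr (P _).
  apply/seteqP; split => w //= _; rewrite /half_line/=.
  by case: (_ < _); [left|right].
- exact: measurable_half.
- exact: measurable_half.
- by rewrite /half_line; apply/seteqP; split => w //= [->].
Qed.

(** The mean of [xi i] is zero, so its positive and negative parts share the
    mean absolute value 1 equally. *)
Lemma integral_half_part i b :
  (\int[P]_w (half_part b (xi i w))%:E = (2^-1)%:E)%E.
Proof.
have ixi := integrable_xi i.
have inorm : P.-integrable setT (EFin \o (fun w => `|xi i w|)).
  exact: integrable_abse ixi.
have := centered i; have := norm1 i; rewrite unlock => norm0 cent0.
transitivity (\int[P]_w ((2^-1)%:E *
    (`|xi i w|%:E + (sgnb b)%:E * (xi i w)%:E)))%E.
  by apply: eq_integral => w _; rewrite -EFinM mulrC.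
rewrite integralZl//; last exact/integrableD/integrableZl.
rewrite integralD//; last exact: integrableZl.
by rewrite integralZl// norm0 cent0 mule0 adde0 mule1.
Qed.

(** A variable of almost surely constant sign would have a half part with
    zero mean. *)
Lemma sgn_prob_gt0 i b : 0 < sgn_prob i b.
Proof.
rewrite lt_neqAle sgn_prob_ge0 andbT eq_sym; apply/negP => /eqP p0.
have := integral_half_part i b.
rewrite (_ : (fun w => _) =
    (EFin \o (half_part b \o xi i)) \_ (xi i @^-1` half_line b)).
  rewrite -integral_mkcond null_set_integral//; last 2 first.
  - apply/measurable_funTS/measurable_EFinP/measurableT_comp => //.
    exact: measurable_half_part.
  - by rewrite /= sgn_probE p0.
  - by move=> -[] /eqP; rewrite eq_sym invr_eq0 pnatr_eq0.
  - exact: measurable_half.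
apply/funext => w; rewrite patchE; case: ifPn => [//|].
rewrite notin_setE/= => wb.
congr EFin; apply/eqP; have := half_part_indic b (xi i w).
have -> : ((0 < xi i w) == b) = false by apply/negP => /eqP.
move/eqP; rewrite mulr0 mulf_eq0 => /orP[|//].
by rewrite /sgnb; case: (b); rewrite ?oppr_eq0 oner_eq0.
Qed.

Definition cell (J : {set 'I_N}) (t : pattern) : set T :=
  \bigcap_(k in [set` J]) xi k @^-1` half_line (t k).

Lemma measurable_cell J t : measurable (cell J t).
Proof.
apply: fin_bigcap_measurable => [|k _]; first exact: finite_finset.
exact: measurable_half.
Qed.

(** On the event that the sign pattern is [t], [xi i] is up to sign its half
    part; the latter vanishes when [xi i] has the other sign, so that the event
    may be replaced by its conditions on the other variables, which are
    independent of [xi i]. *)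
Lemma integral_xi_cell i t :
  (\int[P]_w (xi i w * (sgn_pattern w == t)%:R)%:E =
   (sgnb (t i) / 2 * \prod_(k | k != i) sgn_prob k (t k))%:E)%E.
Proof.
pose B := cell [set~ i] t.
have mB : measurable B by exact: measurable_cell.
have mY : measurable_fun setT (half_part (t i) \o xi i).
  by apply/measurableT_comp => //; exact: measurable_half_part.
pose Y : {RV P >-> R} :=
  HB.pack (half_part (t i) \o xi i) (isMeasurableFun.Build _ _ _ _ _ mY).
have PB : P B = (\prod_(k | k != i) sgn_prob k (t k))%:E.
  rewrite /B /cell indep => [|k _]; last exact: measurable_half_line.
  rewrite -prodEFin; apply: eq_big => [k|k _]; first by rewrite !inE.
  exact: sgn_probE.
transitivity (\int[P]_w ((sgnb (t i))%:E * (Y w * \1_B w)%:E))%E.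
  apply: eq_integral => w _; rewrite -EFinM; congr EFin.
  rewrite mulrA /= half_part_indic -mulrA ?indicE -natrM mulnb.
  congr (_ * (nat_of_bool _)%:R); apply/eqP/andP => [tw|[/eqP ti /set_mem Bw]].
    rewrite -tw ffunE eqxx; split => //; apply/mem_set => k /= _.
    by rewrite /half_line/= -tw ffunE.
  apply/ffunP => k; rewrite ffunE; have [->//|ki] := eqVneq k i.
  by apply: (Bw k); rewrite /= !inE.
have iY : P.-integrable setT (EFin \o Y).
  apply/integrableP; split; first exact/measurable_EFinP.
  rewrite (eq_integral (EFin \o Y)) ?integral_half_part ?ltry// => w _.
  by rewrite /= ger0_norm// half_part_ge0.
rewrite integralZl//; last exact: integrable_mul_indic.
rewrite integral_indep_indic//; first last.
(* Independence, for the events [half_part (xi i) > r] and, at the other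
   indices, the prescribed signs. *)
- move=> r _; pose A k :=
    if k == i then half_part (t i) @^-1` `]r, +oo[ else half_line (t k).
  have mA k : measurable (A k).
    rewrite /A; case: eqP => _; last exact: measurable_half_line.
    rewrite -[X in measurable X]setTI; apply: measurable_half_part => //.
  have := @indep [set: 'I_N]%SET A (fun k _ => mA k).
  rewrite (_ : \bigcap_(k in _) _ = Y @^-1` `]r, +oo[ `&` B) => [->|].
    rewrite (bigD1 i) ?inE//= {1}/A eqxx PB -prodEFin; congr (_ * _)%E.
    apply: eq_big => [k|k]; rewrite !inE //= => ki.
    by rewrite /A (negbTE ki) sgn_probE.
  apply/seteqP; split => w /= => [Aw|[rY Bw] k _].
    split; first by have := Aw i; rewrite /A /= !inE eqxx; exact.
    move=> k /= ; rewrite !inE => ki.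
    by have := Aw k; rewrite /A /= !inE (negbTE ki); exact.
  rewrite /A; case: eqP => [->//|/eqP ki].
  by apply: Bw; rewrite /= !inE.
- by move=> w; exact: half_part_ge0.
rewrite integral_half_part PB -!EFinM; congr EFin; ring.
Qed.

End SignCells.

(** * Distances to finite dimensional subspaces *)

Section Distance.
Context (R : realType) (X : normedModType R).

Definition comb k (b : 'I_k -> X) (a : 'I_k -> R) : X := \sum_j a j *: b j.

Lemma comb_span k (b : 'I_k -> X) a : lin_span b (comb b a).
Proof. by exists a. Qed.

Lemma has_inf_dist k (b : 'I_k -> X) (x : X) :
  has_inf [set `|x - y| | y in lin_span b].
Proof.
split.
  exists `|x - comb b (fun=> 0)|, (comb b (fun=> 0)) => //.
  exact: comb_span.
by exists 0 => _ [y _ <-].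
Qed.

Lemma dist_to_ge0 k (b : 'I_k -> X) (x : X) : 0 <= dist_to x (lin_span b).
Proof.
apply: lb_le_inf; first exact: (has_inf_dist b x).1.
by move=> _ [y _ <-].
Qed.

Lemma dist_to_le k (b : 'I_k -> X) (x : X) a :
  dist_to x (lin_span b) <= `|x - comb b a|.
Proof.
apply: ge_inf; first exact: (has_inf_dist b x).2.
by exists (comb b a) => //; exact: comb_span.
Qed.

Lemma dist_to_adherent k (b : 'I_k -> X) (x : X) e : 0 < e ->
  exists a, `|x - comb b a| < dist_to x (lin_span b) + e.
Proof.
move=> e0; have [_ [y [a _ <-] <-]] := inf_adherent e0 (has_inf_dist b x).
by exists a.
Qed.

Lemma dist_to_ge k (b : 'I_k -> X) (x : X) c :
  (forall a, c <= `|x - comb b a|) -> c <= dist_to x (lin_span b).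
Proof.
move=> le_c; apply: lb_le_inf; first exact: (has_inf_dist b x).1.
by move=> _ [_ [a _ <-] <-]; exact: le_c.
Qed.

Lemma combB k (b : 'I_k -> X) a a' :
  comb b a - comb b a' = comb b (fun j => a j - a' j).
Proof. by rewrite /comb -sumrB; apply: eq_bigr => j _; rewrite scalerBl. Qed.

Lemma subspace_dim_leW m n (Q : set X) :
  (m <= n)%N -> subspace_dim_le m Q -> subspace_dim_le n Q.
Proof.
move=> mn [k [b [km fb ->]]]; exists k, b; split => //.
exact: leq_trans mn.
Qed.

(** Dropping a vector that depends on the others does not change the span, so
    that a spanning family need not be linearly independent. *)
Lemma subspace_dim_le_span k (b : 'I_k -> X) : subspace_dim_le k (lin_span b).
Proof.
elim: k b => [|k IH] b; first by exists 0%N, b; split => // a _ [].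
have [free_b|] := pselect (lin_indep b); first by exists k.+1, b.
move=> /existsNP[c] /not_implyP[c0] /existsNP[i /eqP ci].
suff -> : lin_span b = lin_span (b \o lift i).
  have [m [b' [mk free_b' ->]]] := IH (b \o lift i).
  by exists m, b'; split => //; exact: leqW.
apply/seteqP; split => _ [a _ <-].
  (* Subtract the multiple of the relation that cancels the coefficient of
     [b i]. *)
  exists (fun j => a (lift i j) - a i / c i * c (lift i j)) => //.
  have E0 : \sum_j (a i / c i * c j) *: b j = 0.
    by under eq_bigr do rewrite -scalerA; rewrite -scaler_sumr c0 scaler0.
  transitivity (\sum_j a j *: b j - \sum_j (a i / c i * c j) *: b j);
    last by rewrite E0 subr0.
  rewrite -sumrB [RHS](bigD1_ord i)//= divfK// subrr add0r.
  by apply: eq_bigr => j _; rewrite scalerBl.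
exists (fun j => if unlift i j is Some j' then a j' else 0) => //.
rewrite (bigD1_ord i)//= unlift_none scale0r add0r.
by apply: eq_bigr => j _; rewrite liftK.
Qed.

(** The codes of rational coefficient vectors range over a subset of the
    naturals; the other numbers stand for 0. *)
Definition rat_coef k (m : nat) : 'I_k -> R :=
  if unpickle m is Some f then fun j => ratr ((f : {ffun 'I_k -> rat}) j)
  else fun=> 0.

Lemma rat_coef_dense k (b : 'I_k -> X) (x : X) e : 0 < e ->
  exists m, `|x - comb b (rat_coef m)| < dist_to x (lin_span b) + e.
Proof.
move=> e0; have e20 : 0 < e / 2 by rewrite divr_gt0.
have [a xa] := dist_to_adherent b x e20.
pose M := 1 + \sum_j `|b j|.
have M0 : 0 < M by rewrite ltr_pwDl// sumr_ge0.
pose dl := e / 2 / M.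
have dl0 : 0 < dl by rewrite divr_gt0.
have /choice[f Hf] j : exists r : rat, `|a j - ratr r| < dl.
  have [|r] := @rat_in_itvoo R (a j - dl) (a j + dl); first by lra.
  by rewrite in_itv/= => /andP[l u]; exists r;
    rewrite ltr_distlC; apply/andP; lra.
exists (pickle (finfun f)).
have -> : rat_coef (pickle (finfun f)) = fun j => ratr (f j).
  by rewrite /rat_coef pickleK; apply/funext => j; rewrite ffunE.
apply: le_lt_trans (ler_distD (comb b a) _ _) _.
rewrite combB [ltRHS](_ : _ = dist_to x (lin_span b) + e / 2 + e / 2);
  last by lra.
rewrite ltr_leD//; apply: le_trans (ler_norm_sum _ _ _) _.
apply: (@le_trans _ _ (dl * \sum_j `|b j|)).
  rewrite mulr_sumr; apply: ler_sum => j _; rewrite normrZ ler_wpM2r//.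
  exact/ltW.
rewrite -[leRHS](divfK (lt0r_neq0 M0)) -/dl ler_wpM2l ?(ltW dl0)//.
by rewrite /M lerDr.
Qed.

End Distance.

(** * Measurable selection of almost nearest points *)

Section NearestPoint.
Context (R : realType) (d : measure_display) (T : measurableType d).
Context (P : probability T R) (N : nat) (xi : 'I_N -> {RV P >-> R}).

Definition rvec (w : T) : ell1 R N := \row_i xi i w.

Lemma norm_rvec_comb k (b : 'I_k -> ell1 R N) a w :
  `|rvec w - comb b a| = \sum_i `|xi i w - \sum_j a j * (b j : 'rV_N) 0 i|.
Proof.
rewrite ell1_normE; apply: eq_bigr => i _; congr (`| _ |).
rewrite /rvec [LHS]mxE [X in X + _]mxE; congr (_ + _).
rewrite [LHS]mxE; congr (- _).
have -> : (comb b a : 'rV_N) = \sum_j a j *: (b j : 'rV_N) by [].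
by rewrite summxE; apply: eq_bigr => j _; rewrite mxE.
Qed.

Lemma measurable_norm_comb k (b : 'I_k -> ell1 R N) (a : T -> 'I_k -> R) :
  (forall j, measurable_fun setT (a ^~ j)) ->
  measurable_fun setT (fun w => `|rvec w - comb b (a w)|).
Proof.
move=> ma; under eq_fun do rewrite norm_rvec_comb.
apply: measurable_sum => i; apply: measurableT_comp => //.
apply: measurable_funB; first exact: measurable_funPT.
by apply: measurable_sum => j; exact: measurable_funM.
Qed.

Hypothesis int_xi : forall i, P.-integrable setT (EFin \o xi i).

Lemma integrable_norm_rvec : P.-integrable setT (fun w => `|rvec w|%:E).
Proof.
rewrite (_ : (fun w => _) = (fun w => \sum_i `|xi i w|%:E)%E).
  by apply: integrable_sum => // i _; exact: integrable_abse (int_xi i).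
apply/funext => w; rewrite ell1_normE -sumEFin; apply: eq_bigr => i _.
by rewrite mxE.
Qed.

Variables (k : nat) (b : 'I_k -> ell1 R N).

(** The coefficients of the nearest point to [rvec w] among 0 and the first [m]
    rational points of the span.  They take finitely many values, which
    makes them bounded, hence integrable. *)
Fixpoint best (m : nat) (w : T) : 'I_k -> R :=
  if m is m'.+1 then
    if `|rvec w - comb b (rat_coef R m')| < `|rvec w - comb b (best m' w)|
    then rat_coef R m' else best m' w
  else fun=> 0.

Local Notation err m w := `|rvec w - comb b (best m w)|.

Lemma measurable_best m j : measurable_fun setT (best m ^~ j).
Proof.
elim: m j => [|m IH] j /=; first exact: measurable_cst.
rewrite (_ : (fun w => _) =
  (fun w => if `|rvec w - comb b (rat_coef R m)| < err m w
    then rat_coef R m j else best m w j)); last by apply/funext => w; case: ifP.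
apply: measurable_fun_ifT => //.
by apply: measurable_fun_ltr; exact: measurable_norm_comb.
Qed.

Lemma best_bounded m j : exists M, forall w, `|best m w j| <= M.
Proof.
elim: m => [|m [M IH]]; first by exists 0 => w; rewrite normr0.
exists (Num.max M `|rat_coef R m j|) => w /=; case: ifP => _.
  by rewrite le_max lexx orbT.
by rewrite le_max IH.
Qed.

Lemma err_le_rat m w : err m.+1 w <= `|rvec w - comb b (rat_coef R m)|.
Proof. by rewrite /=; case: ltP. Qed.

Lemma err_nonincreasing w : nonincreasing_seq (fun m => err m w).
Proof. by apply/nonincreasing_seqP => m /=; case: ltP => // /ltW. Qed.

Lemma err_le_norm m w : err m w <= `|rvec w|.
Proof.
have -> : `|rvec w| = err 0 w.
  by rewrite /= /comb big1 ?subr0// => j _; rewrite scale0r.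
exact: err_nonincreasing.
Qed.

Lemma err_cvg w : (fun m => err m w) @ \oo --> dist_to (rvec w) (lin_span b).
Proof.
apply/cvgrPdist_lt => e e0; have [m bm] := rat_coef_dense b (rvec w) e0.
exists m.+1 => // n /= mn.
have errn : err n w < dist_to (rvec w) (lin_span b) + e.
  apply: le_lt_trans bm.
  exact: le_trans (err_nonincreasing w mn) (err_le_rat m w).
rewrite distrC ger0_norm ?subr_ge0 ?dist_to_le//; lra.
Qed.

Lemma measurable_err m : measurable_fun setT (fun w => err m w).
Proof. by apply: measurable_norm_comb => j; exact: measurable_best. Qed.

(** The infimum over the whole span is a limit over countably many points. *)
Lemma measurable_dist_to :
  measurable_fun setT (fun w => dist_to (rvec w) (lin_span b)).
Proof.
apply: (measurable_fun_cvg (h := fun m w => err m w)) => [m|w _].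
  exact: measurable_err.
exact: err_cvg.
Qed.

Lemma dist_to_le_norm w : dist_to (rvec w) (lin_span b) <= `|rvec w|.
Proof. exact: le_trans (dist_to_le b _ _) (err_le_norm 0 w). Qed.

Lemma integrable_dist_to :
  P.-integrable setT (fun w => (dist_to (rvec w) (lin_span b))%:E).
Proof.
apply: le_integrable integrable_norm_rvec => //.
  by apply/measurable_EFinP; exact: measurable_dist_to.
move=> w _ /=.
by rewrite normr_id lee_fin ger0_norm ?dist_to_ge0 ?dist_to_le_norm.
Qed.

Lemma integral_err_cvg :
  (\int[P]_w (err m w)%:E @[m --> \oo] -->
   \int[P]_w (dist_to (rvec w) (lin_span b))%:E)%E.
Proof.
have [|||||_ _] := @dominated_convergence _ T R P setT measurableT
    (fun m w => (err m w)%:E) (fun w => (dist_to (rvec w) (lin_span b))%:E)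
    (fun w => `|rvec w|%:E).
- by move=> m; apply/measurable_EFinP; exact: measurable_err.
- by apply/measurable_EFinP; exact: measurable_dist_to.
- by apply: aeW => w _; apply: cvg_EFin; [exact: nearW|exact: err_cvg].
- exact: integrable_norm_rvec.
- by apply: aeW => w m _ /=; rewrite normr_id lee_fin err_le_norm.
exact.
Qed.

Lemma integrable_best m j : P.-integrable setT (fun w => (best m w j)%:E).
Proof.
have [M bM] := best_bounded m j.
apply: le_integrable (finite_measure_integrable_cst P M measurableT) => //.
  by apply/measurable_EFinP; exact: measurable_best.
by move=> w _ /=; rewrite lee_fin (le_trans (bM w))// ler_norm.
Qed.

End NearestPoint.

(** * The width of the vector and the width of the system *)

Section Duality.
Context (R : realType) (d : measure_display) (T : measurableType d).
Context (P : probability T R) (N : nat) (xi : 'I_N -> {RV P >-> R}).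
Hypothesis int_xi : forall i, P.-integrable setT (EFin \o xi i).
Local Open Scope quotient_scope.
Local Notation Lfun1 := (LfunType P (@lexx _ _ 1%E)).

Lemma integrable_Lfun (f : T -> R) : P.-integrable setT (EFin \o f) ->
  exists F : Lfun1, f = F.
Proof.
move=> /Lfun1_integrable f1.
exists (Sub f f1 : Lfun1).
by rewrite -[LHS](@Lfun_valP _ _ _ P _ (@lexx _ _ 1%E) f f1).
Qed.

Lemma pi_L1_0 : \pi_(L1 P) 0 = 0 :> L1 P.
Proof. by rewrite -(scale0r (0 : Lfun1)) pi_L1Z; exact: (@scale0r _ (L1 P)). Qed.

Lemma pi_L1_comb k (g : 'I_k -> Lfun1) (c : 'I_k -> R) :
  \pi_(L1 P) (\sum_j c j *: g j) = comb (fun j => to_L1 P (g j)) c.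
Proof.
rewrite (big_morph _ (@pi_L1D _ T R P) pi_L1_0); apply: eq_bigr => j _.
by rewrite pi_L1Z to_L1E.
Qed.

Lemma Lfun_combE k (F : Lfun1) (g : 'I_k -> Lfun1) (c : 'I_k -> R) w :
  (F - \sum_j c j *: g j : Lfun1) w = F w - \sum_j c j * g j w.
Proof.
rewrite -[LHS]/(F w - (\sum_j c j *: g j : Lfun1) w); congr (_ - _).
by rewrite (big_morph (fun h : Lfun1 => h w) (id1 := 0) (op1 := +%R)).
Qed.

Lemma norm_L1_comb k (F : Lfun1) (g : 'I_k -> Lfun1) (c : 'I_k -> R) :
  (`|to_L1 P F - comb (fun j => to_L1 P (g j)) c|%:E =
   \int[P]_w `|F w - \sum_j c j * g j w|%:E)%E.
Proof.
have -> : to_L1 P F - comb (fun j => to_L1 P (g j)) c =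
    \pi_(L1 P) (F - \sum_j c j *: g j).
  rewrite -pi_L1_comb to_L1E pi_L1D; congr (_ + _).
  by rewrite -[in RHS]scaleN1r pi_L1Z; exact/esym/(@scaleN1r _ (L1 P)).
rewrite L1_norm_piE; apply: eq_integral => w _; congr (`| _ |%:E).
exact: Lfun_combE.
Qed.

(** The same matrix [a j w] times [b j i] approximates the family [xi] in both
    spaces: by columns it is a combination of the vectors [b j], by rows a
    combination of the functions [a j]. *)
Lemma integral_norm_rvec_comb k (b : 'I_k -> ell1 R N) (a : 'I_k -> Lfun1) :
  (\int[P]_w `|rvec xi w - comb b (a ^~ w)|%:E =
   (\sum_i `|to_L1 P (xi i) -
     comb (fun j => to_L1 P (a j)) (fun j => (b j : 'rV_N) 0%R i)|)%:E)%E.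
Proof.
under eq_integral do rewrite norm_rvec_comb -sumEFin.
rewrite integral_sum => // [|i].
  rewrite -sumEFin; apply: eq_bigr => i _.
  have [F xiF] := integrable_Lfun (int_xi i).
  rewrite xiF norm_L1_comb; apply: eq_integral => w _.
  by congr (`|_ - _|%:E); apply: eq_bigr => j _; rewrite mulrC.
have [F xiF] := integrable_Lfun (int_xi i).
rewrite xiF.
rewrite (_ : (fun w => _) =
    abse \o (EFin \o (F - \sum_j (b j : 'rV_N) 0 i *: a j : Lfun1))).
  by apply: integrable_abse; apply/Lfun1_integrable; exact: LfunP.
apply/funext => w; rewrite -[RHS]/(`|_ w|%:E) Lfun_combE; congr (`|_|%:E).
by congr (_ - _); apply: eq_bigr => j _; rewrite mulrC.
Qed.

Variable n : nat.

(** The rows of coefficients of almost nearest points of the span of [a] to the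
    functions [xi i] are read as columns [b j], which span the subspace of
    the sequence space. *)
Lemma avg_width_le_sys k (a : 'I_k -> L1 P) : (k <= n)%N ->
  (avg_width P n (rvec xi) <=
    (\sum_i dist_to (to_L1 P (xi i)) (lin_span a))%:E)%E.
Proof.
move=> kn; apply/lee_addgt0Pr => e e0.
pose e' := e / N.+1%:R.
have e'0 : 0 < e' by rewrite divr_gt0.
have /choice[c Hc] i := dist_to_adherent a (to_L1 P (xi i)) e'0.
pose b j : ell1 R N := \row_i c i j.
pose f j : Lfun1 := repr (a j).
have af : a = fun j => to_L1 P (f j).
  by apply/funext => j; rewrite to_L1E reprK.
apply: (@le_trans _ _ (\int[P]_w (dist_to (rvec xi w) (lin_span b))%:E)%E).
  apply: ereal_inf_lbound; exists (lin_span b); last by rewrite unlock.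
  exact: subspace_dim_leW (subspace_dim_le_span _).
apply: (@le_trans _ _ (\int[P]_w `|rvec xi w - comb b (f ^~ w)|%:E)%E).
  apply: ge0_le_integral => //.
  - by move=> w _; rewrite lee_fin dist_to_ge0.
  - by apply/measurable_EFinP; exact: measurable_dist_to.
  - apply/measurable_EFinP; apply: measurable_norm_comb => j.
    exact: measurable_funPT.
  - by move=> w _; rewrite lee_fin dist_to_le.
rewrite integral_norm_rvec_comb -EFinD lee_fin -af.
apply: (@le_trans _ _ (\sum_i (dist_to (to_L1 P (xi i)) (lin_span a) + e'))).
  apply: ler_sum => i _; apply: le_trans (ltW (Hc i)).
  rewrite le_eqVlt; apply/orP; left; apply/eqP; congr (`|_ - comb _ _|).
  by apply/funext => j; rewrite mxE.
rewrite big_split/= lerD2l sumr_const card_ord -mulr_natr.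
rewrite /e' mulrAC ler_pdivrMr//.
by rewrite ler_pM2l// ler_nat.
Qed.

(** The selected coefficients of almost nearest points span a subspace of [L1];
    let their number of candidates grow. *)
Lemma sys_le_avg_width k (b : 'I_k -> ell1 R N) : (0 < N)%N -> (k <= n)%N ->
  ((N%:R * avg_width_sys n (fun i => to_L1 P (xi i)))%:E <=
   \int[P]_w (dist_to (rvec xi w) (lin_span b))%:E)%E.
Proof.
move=> N0 kn; apply: (cvge_to_ge (integral_err_cvg int_xi (b := b))).
apply: nearW => m.
have /choice[f Hf] j : exists F : Lfun1, best xi b m ^~ j = F.
  by apply: integrable_Lfun; exact: integrable_best.
have -> : (\int[P]_w `|rvec xi w - comb b (best xi b m w)|%:E =
   \int[P]_w `|rvec xi w - comb b (f ^~ w)|%:E)%E.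
  apply: eq_integral => w _; congr (`|_ - comb _ _|%:E).
  by apply/funext => j; rewrite -Hf.
rewrite integral_norm_rvec_comb lee_fin mulrC -ler_pdivlMr ?ltr0n// mulrC.
apply: (@le_trans _ _ (N%:R^-1 * \sum_i
    dist_to (to_L1 P (xi i)) (lin_span (fun j => to_L1 P (f j))))).
  apply: ge_inf; last first.
    exists (lin_span (fun j => to_L1 P (f j))) => //.
    exact: subspace_dim_leW (subspace_dim_le_span _).
  exists 0 => _ [Q [l [c [_ _ ->]]] <-].
  by rewrite mulr_ge0// sumr_ge0// => i _; exact: dist_to_ge0.
rewrite ler_wpM2l ?invr_ge0//; apply: ler_sum => i _; exact: dist_to_le.
Qed.

Lemma avg_width_sysE : (0 < N)%N ->
  ((avg_width_sys n (fun i => to_L1 P (xi i)))%:E =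
   (N%:R^-1)%:E * avg_width P n (rvec xi))%E.
Proof.
move=> N0.
suff -> : avg_width P n (rvec xi) =
    (N%:R * avg_width_sys n (fun i => to_L1 P (xi i)))%:E.
  by rewrite -EFinM mulKf// pnatr_eq0 -lt0n.
apply/eqP; rewrite eq_le; apply/andP; split; last first.
  apply: le_ereal_inf_tmp => _ [Q [l [b [ln _ ->]]] <-]; rewrite unlock.
  exact: sys_le_avg_width.
apply/lee_addgt0Pr => e e0.
have e'0 : 0 < N%:R^-1 * e by rewrite mulr_gt0 ?invr_gt0 ?ltr0n.
have [|_ [Q [l [a [ln _ ->]]] <-]] := inf_adherent e'0
    (E := [set N%:R^-1 * \sum_i dist_to (to_L1 P (xi i)) Q |
           Q in subspace_dim_le n]).
  split.
    eexists; exists (lin_span (fun j : 'I_0 => 0)); last by [].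
    exact: subspace_dim_leW (subspace_dim_le_span _).
  exists 0 => _ [Q [l [c [_ _ ->]]] <-].
  by rewrite mulr_ge0// sumr_ge0// => i _; exact: dist_to_ge0.
move=> lt_e; apply: le_trans (avg_width_le_sys a ln) _.
rewrite -EFinD lee_fin -[leLHS](mulVKf (x := N%:R)) ?pnatr_eq0 -?lt0n//.
rewrite -[e in leRHS](mulVKf (x := N%:R)) ?pnatr_eq0 -?lt0n// -mulrDr.
by rewrite ler_wpM2l// ltW.
Qed.

End Duality.

(** * The lower bound *)

Section LowerBound.
Context (R : realType) (d : measure_display) (T : measurableType d).
Context (P : probability T R) (N : nat) (xi : 'I_N -> {RV P >-> R}).
Hypothesis indep : mutually_independent xi.
Hypothesis centered : (forall i, 'E_P[xi i] = 0%:E)%E.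
Hypothesis norm1 : (forall i, 'E_P[fun w => `|xi i w|%R] = 1%:E)%E.

Local Notation pattern := {ffun 'I_N -> bool}.

Lemma integrable_xi_cell i (t : pattern) :
  P.-integrable setT (fun w => (xi i w * (sgn_pattern xi w == t)%:R)%:E).
Proof.
pose B := cell xi [set: 'I_N]%SET t.
rewrite (_ : (fun w => _) = (fun w => (xi i w * \1_B w)%:E)).
  apply: integrable_mul_indic; first exact: measurable_cell.
  exact: integrable_xi.
apply/funext => w /=; rewrite indicE; congr (_ * (nat_of_bool _)%:R)%:E.
apply/eqP/idP => [tw|/set_mem tw].
  by apply/mem_set => k /= _; rewrite /half_line/= -tw ffunE.
by apply/ffunP => k; rewrite ffunE; apply: tw; rewrite /= inE.
Qed.

Lemma sum_sgn_patternE (z : pattern -> 'rV[R]_N) w :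
  ((\sum_i xi i w * z (sgn_pattern xi w) 0 i)%:E = \sum_(t : pattern) \sum_i
    ((z t 0 i)%:E * (xi i w * (sgn_pattern xi w == t)%:R)%:E))%E.
Proof.
under [RHS]eq_bigr do rewrite sumEFin.
rewrite sumEFin; congr EFin.
rewrite (bigD1 (sgn_pattern xi w))//= [X in _ + X]big1 ?addr0.
  by apply: eq_bigr => i _; rewrite eqxx mulr1 mulrC.
move=> t; rewrite eq_sym => /negbTE nt.
by rewrite big1// => i _; rewrite nt !mulr0.
Qed.

Lemma integrable_sum_sgn_pattern (z : pattern -> 'rV[R]_N) :
  P.-integrable setT (fun w => (\sum_i xi i w * z (sgn_pattern xi w) 0 i)%:E).
Proof.
under eq_fun do rewrite sum_sgn_patternE.
apply: integrable_sum => // t _; apply: integrable_sum => // i _.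
by apply: integrableZl => //; exact: integrable_xi_cell.
Qed.

(** The quotient by [2 * sgn_prob] is the conditional expectation of [xi i]
    given its sign. *)
Lemma mean_sgn_prob (z : pattern -> 'rV[R]_N) :
  (\int[P]_w (\sum_i xi i w * z (sgn_pattern xi w) 0 i)%:E =
   (mean (sgn_prob xi) (fun t =>
     \sum_i sgnb R (t i) / (2 * sgn_prob xi i (t i)) * z t 0 i))%:E)%E.
Proof.
under eq_integral do rewrite sum_sgn_patternE.
rewrite integral_sum//; last first.
  move=> t; apply: integrable_sum => // i _; apply: integrableZl => //.
  exact: integrable_xi_cell.
rewrite /mean -sumEFin; apply: eq_bigr => t _.
rewrite integral_sum//; last first.
  move=> i; apply: integrableZl => //; exact: integrable_xi_cell.
rewrite mulr_sumr -sumEFin; apply: eq_bigr => i _.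
rewrite integralZl//; last exact: integrable_xi_cell.
rewrite integral_xi_cell// -EFinM; congr EFin.
rewrite [X in _ = X * _](bigD1 i)//=.
have := sgn_prob_gt0 centered norm1 i (t i); move: (sgn_prob _ _ _) => p p0.
move: (\prod_(_ | _) _) => W; field; exact: lt0r_neq0.
Qed.

(** The numerator is the guaranteed correlation of the certificate with [xi],
    the denominator the bound on its entries. *)
Lemma integral_dist_ge K k (b : 'I_k -> ell1 R N) : 0 < K ->
  (((N%:R - k%:R - N%:R / K ^+ 2) / (K + 2))%:E <=
   \int[P]_w (dist_to (rvec xi w) (lin_span b))%:E)%E.
Proof.
move=> K0.
pose B := \matrix_(j < k, i < N) (b j : 'rV_N) 0 i.
pose mu := sgn_prob xi.
have mu0 i e : 0 < mu i e by exact: sgn_prob_gt0.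
have muT i : mu i true + mu i false = 1 by exact: sgn_prob_total.
have ix i : P.-integrable setT (EFin \o xi i) by exact: integrable_xi.
have K2 : 0 < K + 2 by rewrite addr_gt0.
(* The increments: 1 and -1, minus the mean of the sign. *)
have [|||||z [zB zK zmean]] := @exists_correlated_certificate R N k B K K0 mu
    (fun i e => if e then 2 * mu i false else - (2 * mu i true))
    (fun i e => sgnb R e / (2 * mu i e)) _ muT.
- by move=> i e; exact: ltW.
- by move=> j; ring.
- move=> j e; have := muT j; have := mu0 j true; have := mu0 j false.
  by case: e => ? ? ?; rewrite ler_norml; lra.
- move=> j; have := muT j; have := mu0 j true; have := mu0 j false.
  move: (mu j true) (mu j false) => p q q0 p0 pq.
  have -> : q = 1 - p by lra.
  have := sqr_ge0 (2 * p - 1); nra.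
- move=> j; have := muT j; have := mu0 j true; have := mu0 j false.
  rewrite /sgnb; move: (mu j true) (mu j false) => p q q0 p0 pq.
  by rewrite -[RHS]pq; field; rewrite !lt0r_neq0.
(* Pair with [z]: the bound [K + 2] on its entries turns the pairing into a
   lower bound for the distance. *)
pose S w := \sum_i xi i w * z (sgn_pattern xi w) 0 i.
have iS : P.-integrable setT (fun w => (S w)%:E).
  exact: integrable_sum_sgn_pattern.
apply: (@le_trans _ _ (\int[P]_w ((K + 2)^-1%:E * (S w)%:E)))%E.
  rewrite integralZl// mean_sgn_prob -EFinM lee_fin mulrC.
  by rewrite ler_wpM2l// invr_ge0 ltW.
apply: le_integral => //.
- exact: integrableZl.
- exact: integrable_dist_to.
move=> w _; rewrite -EFinM lee_fin; apply: dist_to_ge => a.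
rewrite mulrC ler_pdivrMr// norm_rvec_comb mulr_suml /S.
set zw := z _.
have orth : \sum_i (\sum_j a j * (b j : 'rV_N) 0 i) * zw 0 i = 0.
  under eq_bigr do rewrite mulr_suml.
  rewrite exchange_big big1//= => j _.
  under eq_bigr do rewrite -mulrA.
  rewrite -mulr_sumr.
  have /rowP/(_ j) := zB (sgn_pattern xi w); rewrite !mxE => E.
  rewrite -[X in _ * X](_ : 0 = _) ?mulr0// -[LHS]E.
  by apply: eq_bigr => i _; rewrite !mxE mulrC.
rewrite -[leLHS]subr0 -[X in _ - X]orth -sumrB; apply: ler_sum => i _.
rewrite -mulrBl; apply: le_trans (ler_norm _) _; rewrite normrM.
by rewrite ler_wpM2l // zK.
Qed.

End LowerBound.

Theorem theorem1p1 :
  forall (R : realType) (eps : R), 0 < eps < 1 ->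
  exists c : R, 0 < c /\
  forall (d : measure_display) (T : measurableType d) (P : probability T R)
    (N : nat) (xi : 'I_N -> {RV P >-> R}),
    (0 < N)%N ->
    mutually_independent xi ->
    (forall i, 'E_P[xi i] = 0%:E)%E ->
    (forall i, 'E_P[fun w => `|xi i w|%R] = 1%:E)%E ->
  forall n : nat, n%:R <= N%:R * (1 - eps) ->
    ((avg_width_sys n (fun i => to_L1 P (xi i)))%:E =
       (N%:R^-1)%:E * avg_width P n (fun w => \row_i xi i w : ell1 R N))%E /\
    (c%:E <= (N%:R^-1)%:E * avg_width P n (fun w => \row_i xi i w : ell1 R N))%E.
Proof.
move=> R eps /andP[eps0 eps1]; exists (eps ^+ 2 / 8).
split; first by rewrite divr_gt0// exprn_gt0.
move=> d T P N xi N0 indep centered norm1 n nN.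
have ix i : P.-integrable setT (EFin \o xi i) by exact: integrable_xi.
split; first exact: avg_width_sysE.
have N0' : 0 < N%:R :> R by rewrite ltr0n.
apply: (@le_trans _ _ ((N%:R^-1)%:E * (N%:R * (eps ^+ 2 / 8))%:E)%E).
  by rewrite -EFinM mulKf// lt0r_neq0.
rewrite lee_pmul2l// ?lte_fin ?invr_gt0//.
apply: le_ereal_inf_tmp => _ [Q [k [b [kn _ ->]]] <-]; rewrite unlock.
(* Coordinates freeze at the level [2 / eps], so that on average at most
   [N * eps ^+ 2 / 4] of them do. *)
have K0 : 0 < 2 / eps by rewrite divr_gt0.
apply: le_trans (integral_dist_ge indep centered norm1 b K0); rewrite lee_fin.
have kN : k%:R <= N%:R * (1 - eps) by apply: le_trans nN; rewrite ler_nat.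
rewrite ler_pdivlMr ?addr_gt0//.
have -> : N%:R / (2 / eps) ^+ 2 = N%:R * (eps ^+ 2 / 4).
  by field; exact: lt0r_neq0.
have -> : N%:R * (eps ^+ 2 / 8) * (2 / eps + 2) =
    N%:R * ((eps + eps ^+ 2) / 4).
  by field; exact: lt0r_neq0.
have : 0 <= N%:R * (eps * (3 - 2 * eps)) by rewrite !mulr_ge0//; lra.
lra.
Qed.
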